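(* Let $n\ge 1$. We have $$|\mathrm{Av}_n(1342,3142,3412,3421)|=\binom{2n-2}{n-1}.$$ For every integer $m\ge 0$, the number of elements of $\mathrm{Av}_n(1342,3142,3412,3421)$ with exactly $m$ descents is $$\binom{n-1}{m}^2,$$ and the number of elements of $\mathrm{Av}_n(1342,3142,3412,3421)$ with exactly $m$ peaks is $$2^{n-2m-1}\binom{n-1}{2m}\binom{2m}{m}.$$
   Context: $\mathrm{Av}_n(\tau^{(1)},\ldots,\tau^{(r)})$ is the set of permutations of $\{1,\ldots,n\}$ (written as words) avoiding, in the classical sense, all the patterns $\tau^{(1)},\ldots,\tau^{(r)}$. A descent of $\pi=\pi_1\cdots\pi_n$ is an index $i\in\{1,\ldots,n-1\}$ with $\pi_i>\pi_{i+1}$; a peak is an index $i\in\{2,\ldots,n-1\}$ with $\pi_{i-1}<\pi_i>\pi_{i+1}$. Binomial coefficients $\binom ab$ are $0$ unless $0\le b\le a$. *)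

(* Defs.v *)
From mathcomp Require Import all_boot all_fingroup.

Set Implicit Arguments.
Unset Strict Implicit.
Unset Printing Implicit Defensive.

(* Permutations of {1, ..., n} are represented by 'S_n, i.e. positions and    *)
(* values are both shifted down by one; none of the notions below depends on  *)
(* this shift. Patterns are given as words, e.g. 1342 is [:: 1; 3; 4; 2].     *)

(* The function f selects the positions of an occurrence of tau in s; the     *)
(* equivalence says that the selected subword is order-isomorphic to tau.     *)
Definition contains (n : nat) (s : 'S_n) (tau : seq nat) : bool :=
  [exists f : {ffun 'I_(size tau) -> 'I_n},
    [forall i : 'I_(size tau), forall j : 'I_(size tau),
      (i < j) ==> (f i < f j)] &&
    [forall i : 'I_(size tau), forall j : 'I_(size tau),
      (nth 0 tau i < nth 0 tau j) == (s (f i) < s (f j))]].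

Definition Av (n : nat) (taus : seq (seq nat)) : {set 'S_n} :=
  [set s : 'S_n | all (fun tau => ~~ contains s tau) taus].

Definition descents (n : nat) (s : 'S_n) : {set 'I_n} :=
  [set i : 'I_n | [exists j : 'I_n, (j == i.+1 :> nat) && (s j < s i)]].

Definition peaks (n : nat) (s : 'S_n) : {set 'I_n} :=
  [set i : 'I_n | [exists h : 'I_n, exists j : 'I_n,
    [&& i == h.+1 :> nat, j == i.+1 :> nat, s h < s i & s j < s i]]].

Definition patterns : seq (seq nat) :=
  [:: [:: 1; 3; 4; 2]; [:: 3; 1; 4; 2]; [:: 3; 4; 1; 2]; [:: 3; 4; 2; 1]].

(* Main.v *)
(* Each of the four patterns is 342 with a 1 inserted, so a permutation avoids
   them all iff every occurrence of 231 uses the least value as its "1". Such a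
   permutation is a decreasing binary tree whose shape is arbitrary (the right
   subtree of a node holds larger values than the left one), except that the
   least value may sit at any leaf: a binary tree with a marked leaf. Descents
   are the nodes with a right child, peaks are the nodes with two children.

   Reading the path from the root to the marked leaf, together with the trees
   hanging off it, encodes the marked tree as a word of length n - 1 over the
   steps U, D and two kinds of level steps, with as many U as D: a tree hanging
   to the right gives U ... D, one hanging to the left gives D ... U, in both
   cases around the usual two-coloured Motzkin word of the tree. Representing
   U, D and the level steps by (1,0), (0,1), (1,1), (0,0), a balanced word is a
   pair of subsets of the same size m of an (n-1)-set, where m is the number of
   descents, while the number of peaks is the number of U. *)
Require Import Defs.
From mathcomp Require Import all_boot all_fingroup.
From mathcomp Require Import zify.

Set Implicit Arguments.
Unset Strict Implicit.
Unset Printing Implicit Defensive.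

(** * Counting along a one-to-one correspondence *)

(** Permutations and words are linked by a path that is only known to exist, so the bijection is
    given as a relation. Its pairs are removed one at a time along [l]. *)
Lemma card_eq_size_of_rel (A : finType) (B : eqType) (r : A -> B -> Prop)
    (X : {set A}) (l : seq B) :
    uniq l ->
    (forall a, a \in X -> exists2 b, b \in l & r a b) ->
    (forall b, b \in l -> exists2 a, a \in X & r a b) ->
    (forall a b b', r a b -> r a b' -> b = b') ->
    (forall a a' b, r a b -> r a' b -> a = a') ->
  #|X| = size l.
Proof.
move=> + + + rfun rinj; elim: l X => [|b l IH] X.
  move=> _ Xl _; apply/eqP; rewrite cards_eq0 -subset0; apply/subsetP => a aX.
  by have [b] := Xl a aX.
move=> /= /andP[bl ul] Xl lX.
have [a aX rab] := lX b (mem_head _ _).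
rewrite (cardsD1 a) aX add1n; congr S; apply: IH => //.
- move=> a'; rewrite !inE => /andP[na' a'X].
  have [b'] := Xl a' a'X; rewrite inE => /predU1P[-> ra'b|b'l ra'b'].
    by rewrite (rinj _ _ _ ra'b rab) eqxx in na'.
  by exists b'.
- move=> b' b'l; have [|a' a'X ra'b'] := lX b'; first by rewrite inE b'l orbT.
  exists a' => //; rewrite !inE a'X andbT; apply/eqP => aa'.
  by move: bl; rewrite (rfun a b b') // -?aa' // b'l.
Qed.

(** * Codes of binary trees and of marked trees *)

Inductive tree := E | N of tree & tree.

Definition is_E t := if t is E then true else false.

Definition letter := (bool * bool)%type.

(* The code of a nonempty tree, with U = (e, ~~ e) and D = (~~ e, e). It is the
   Lukasiewicz word of the tree without its last letter, which is always D. *)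
Fixpoint code (e : bool) (t : tree) : seq letter :=
  match t with
  | E => [::]
  | N E E => [::]
  | N E r => (true, true) :: code e r
  | N l E => (false, false) :: code e l
  | N l r => (e, ~~ e) :: code e l ++ (~~ e, e) :: code e r
  end.

Lemma codeN e l r : code e (N l r) =
  if is_E l then if is_E r then [::] else (true, true) :: code e r
  else if is_E r then (false, false) :: code e l
  else (e, ~~ e) :: code e l ++ (~~ e, e) :: code e r.
Proof. by case: l r => [|? ?] [|? ?]. Qed.

(* A list [p] is the path from the root of a tree to its marked leaf: [(d, t)]
   says that the path goes right if [d], left otherwise, and that [t] is the
   subtree on the other side. *)
Fixpoint zcode (p : seq (bool * tree)) : seq letter :=
  if p is (d, t) :: p' then
    if is_E t then (d, d) :: zcode p'
    else (~~ d, d) :: code (~~ d) t ++ (d, ~~ d) :: zcode p'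
  else [::].

(** Both U and D count the nodes with two children, whatever the orientation [e]. *)
Lemma code_balanced e f t :
  count_mem (f, ~~ f) (code e t) = count_mem (true, false) (code true t).
Proof.
elim: t => // l IHl r IHr; rewrite !codeN.
case: (is_E l); case: (is_E r) => //=;
  rewrite ?IHl ?IHr ?count_cat /= ?IHl ?IHr.
- by case: (f).
- by case: (f).
- by case: (e); case: (f); rewrite /=; lia.
Qed.

(** With the missing last letter restored the codes form a prefix code: the first letter tells which
    children the root has. *)
Lemma code_cat_inj e t t' w w' : ~~ is_E t -> ~~ is_E t' ->
  code e t ++ (~~ e, e) :: w = code e t' ++ (~~ e, e) :: w' -> t = t' /\ w = w'.
Proof.
elim: t t' w w' => // l IHl r IHr [//|l' r'] w w' _ _.
rewrite !codeN.
case El: (is_E l) IHl; case Er: (is_E r) IHr; case El': (is_E l');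
  case Er': (is_E r') => IHr IHl /=;
  try by case: e {IHl IHr}.
- case: l l' r r' El El' Er Er' {IHl IHr} => [|? ?] [|? ?] [|? ?] [|? ?] // _ _ _ _.
  by case.
- case: l l' El El' {IHl} => [|? ?] [|? ?] // _ _.
  by case=> /IHr; rewrite Er'=> [[]// -> ->].
- case: r r' Er Er' {IHr} => [|? ?] [|? ?] // _ _.
  by case=> /IHl; rewrite El'=> [[]// -> ->].
- case; rewrite -!catA !cat_cons => /IHl; rewrite El' => -[] // -> /IHr.
  by rewrite Er' => -[] // -> ->.
Qed.

Lemma zcode_inj : injective zcode.
Proof.
elim=> [|[d t] p IH] [|[d' t'] p'] //=; try by case: ifP.
case Et: (is_E t); case Et': (is_E t').
- case: t t' Et Et' => [|? ?] [|? ?] // _ _.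
  by case=> -> _ /IH ->.
- by case: d; case: d'.
- by case: d; case: d'.
- case=> _ <- eqc; have := @code_cat_inj (~~ d) t t' (zcode p) (zcode p').
  by rewrite Et Et' negbK => -[] // -> /IH ->.
Qed.

(* [w] is split at the first time it goes below its starting height. *)
Lemma code_parse e w : count_mem (e, ~~ e) w < count_mem (~~ e, e) w ->
  exists t w', ~~ is_E t /\ w = code e t ++ (~~ e, e) :: w'.
Proof.
have [k] := ubnP (size w); elim: k w => // k IH [|[x y] w] //= sw.
case: (eqVneq x y) => [<-|nxy].
  have [-> ->] : ((x, x) == (e, ~~ e)) = false /\ ((x, x) == (~~ e, e)) = false.
    by case: e x {IH} => -[].
  rewrite !add0n => lt1; have [//|//|t [w' [Et ->]]] := IH w.
  exists (if x then N E t else N t E), w'.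
  by case: x Et; case: t.
have -> : y = ~~ x by case: x y nxy => -[].
have [-> _|nxe] := eqVneq x (~~ e).
  by exists (N E E), w; rewrite negbK.
have -> : x = e by case: (x) (e) nxe => -[].
rewrite eqxx; have -> : ((e, ~~ e) == (~~ e, e)) = false by case: (e).
rewrite add0n => lt1; have [//||l [w2 [El Ew]]] := IH w.
  exact: ltnW lt1.
have [||r [w3 [Er Ew2]]] := IH w2.
- by move: sw; rewrite Ew size_cat /=; lia.
- move: lt1; rewrite Ew !count_cat /= -[X in (~~ e, X)]negbK !code_balanced.
  rewrite negbK eqxx; have -> : ((~~ e, e) == (e, ~~ e)) = false by case: (e).
  lia.
exists (N l r), w3; split => //.
by rewrite codeN (negbTE El) (negbTE Er) Ew Ew2 /= -catA.
Qed.

(** A level letter hangs an empty tree. Any other first letter is compensated later, and what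
    precedes the first return is the code of one hanging tree. *)
Lemma zcode_parse w : count_mem (true, false) w = count_mem (false, true) w ->
  exists p, w = zcode p.
Proof.
have [k] := ubnP (size w); elim: k w => // k IH [|[x y] w] /= sw.
  by exists [::].
case: (eqVneq x y) => [<-|nxy].
  have [-> ->] : ((x, x) == (true, false)) = false
    /\ ((x, x) == (false, true)) = false.
    by case: x.
  rewrite !add0n => eq1; have [//|//|p ->] := IH w.
  by exists ((x, E) :: p).
have -> : y = ~~ x by case: x y nxy => -[].
move=> eq1; have [|t [w' [Et Ew]]] := @code_parse x w.
  by case: x eq1 {nxy} => /=; lia.
have [||p Ep] := IH w'.
- by move: sw; rewrite Ew size_cat /=; lia.
- move: eq1; rewrite Ew !count_cat /= (code_balanced x true) (code_balanced x false).
  by case: x {nxy Ew} => /=; lia.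
exists ((~~ x, t) :: p).
by rewrite /= (negbTE Et) negbK Ew Ep.
Qed.

Lemma zcode_balanced p :
  count_mem (true, false) (zcode p) = count_mem (false, true) (zcode p).
Proof.
elim: p => // -[d t] p IH /=; case: (is_E t) => /=; first by case: d; rewrite /= IH.
rewrite !count_cat /= (code_balanced _ true) (code_balanced _ false).
rewrite IH; case: d => /=; lia.
Qed.

(** * Enumeration of words by two statistics *)

Definition letters : seq letter :=
  [:: (true, true); (true, false); (false, true); (false, false)].

Fixpoint words (k : nat) : seq (seq letter) :=
  if k is k'.+1 then [seq x :: w | x <- letters, w <- words k'] else [:: [::]].

Lemma mem_words k w : (w \in words k) = (size w == k).
Proof.
elim: k w => [|k IH] [|x w] //.
  by apply/allpairsPdep => -[? [? []]].
rewrite eqSS -IH; apply/allpairsPdep/idP => [[y [v [_ vk [_ ->]]]] //|wk].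
by exists x, w; split=> //; case: x => -[] [].
Qed.

Lemma words_uniq k : uniq (words k).
Proof.
elim: k => // k IH; apply: allpairs_uniq => //.
by move=> [x v] [y w] _ _ [-> ->].
Qed.

Lemma count_shift (T : Type) (f g : T -> nat) (b c : bool) p q (s : seq T) :
  count (fun w => (b + f w == p) && (c + g w == q)) s
  = (b <= p) * (c <= q) * count (fun w => (f w == p - b) && (g w == q - c)) s.
Proof.
have shiftE (d : bool) x y : (d + x == y) = (d <= y) && (x == y - d) by lia.
rewrite (eq_count (fun w => congr2 andb (shiftE b (f w) p) (shiftE c (g w) q))).
by case: (b <= p); case: (c <= q); rewrite ?mul1n // (eq_count (a2 := pred0))
  ?count_pred0 // => w; rewrite /= ?andbF.
Qed.

Definition count_words (f g : pred letter) k p q :=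
  count (fun w => (count f w == p) && (count g w == q)) (words k).

Lemma count_wordsS f g k p q : count_words f g k.+1 p q =
  \sum_(x <- letters)
    (f x <= p) * (g x <= q) * count_words f g k (p - f x) (q - g x).
Proof.
rewrite /count_words count_flatten sumnE !big_map; apply: eq_bigr => x _.
by rewrite count_map -count_shift.
Qed.

(** A word is a pair of independent subsets of a [k]-set; the recursion is a product of two Pascal
    recurrences. *)
Lemma count_words_fst_snd k p q :
  count_words fst snd k p q = 'C(k, p) * 'C(k, q).
Proof.
elim: k p q => [|k IH] p q; first by case: p q => [|p] [|q].
rewrite count_wordsS !big_cons big_nil /= !IH.
by case: p q => [|p] [|q]; rewrite ?binS ?bin0 ?subn0 ?subn1 /=; lia.
Qed.

(** Choose the places of U and D, then those of U among them, then one of two colours at each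
    remaining place. *)
Lemma count_words_peaks k p q :
  count_words (pred1 (true, false)) (pred1 (false, true)) k p q
  = 2 ^ (k - (p + q)) * 'C(k, p + q) * 'C(p + q, p).
Proof.
elim: k p q => [|k IH] p q; first by case: p q => [|p] [|q].
rewrite count_wordsS !big_cons big_nil /= !IH.
(* For [j <= k] the exponent drops by exactly one; beyond that the binomial vanishes, which absorbs
   the truncated subtraction. *)
have pow2 j : 2 ^ (k.+1 - j) * 'C(k, j) = 2 * 2 ^ (k - j) * 'C(k, j).
  have [jk|kj] := leqP j k; first by rewrite subSn // expnS.
  by rewrite bin_small // !muln0.
case: p q => [|p] [|q]; rewrite ?(addSn, addnS, addn0, add0n, subn0, subn1) /=.
- rewrite !bin0 expnS. lia.
- have := pow2 q.+1; rewrite ?subSS ?binS ?bin0. lia.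
- have := pow2 p.+1. rewrite ?binn ?subSS ?binS ?binn. lia.
- by have := pow2 (p + q).+2; rewrite !subSS !binS (mulnDr (2 ^ _)) => ->; lia.
Qed.

(** * Words of numbers read off trees and marked trees *)

Fixpoint tsize t := if t is N l r then (tsize l + tsize r).+1 else 0.

Lemma tsize_eq0 t : (tsize t == 0) = is_E t.
Proof. by case: t. Qed.

Definition zsize (p : seq (bool * tree)) := sumn [seq (tsize x.2).+1 | x <- p].

(* The values used are [b], ..., [b + tsize t - 1]; those in [zword b p] are
   [b], ..., [b + zsize p - 1], and 0 at the marked leaf. *)
Fixpoint word b t :=
  if t is N l r
  then word b l ++ (b + tsize l + tsize r) :: word (b + tsize l) r
  else [::].

Arguments zsize : simpl never.

Lemma zsize_cons d t p : zsize ((d, t) :: p) = (tsize t + zsize p).+1.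
Proof. by []. Qed.

Fixpoint zword b (p : seq (bool * tree)) :=
  match p with
  | [::] => [:: 0]
  | (false, r) :: p' =>
      zword b p' ++ (b + zsize p' + tsize r) :: word (b + zsize p') r
  | (true, l) :: p' =>
      word b l ++ (b + tsize l + zsize p') :: zword (b + tsize l) p'
  end.

Lemma perm_iota_cat_max (u v : seq nat) b k l :
  perm_eq u (iota b k) -> perm_eq v (iota (b + k) l) ->
  perm_eq (u ++ (b + k + l) :: v) (iota b (k + l).+1).
Proof.
move=> pu pv; rewrite -addn1 !iotaD /= addnA -catA (perm_cat pu) //.
by rewrite cats1 perm_sym perm_rcons perm_cons perm_sym.
Qed.

Lemma perm_word b t : perm_eq (word b t) (iota b (tsize t)).
Proof. by elim: t b => // l IHl r IHr b /=; apply: perm_iota_cat_max. Qed.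

Lemma mem_word b t : word b t =i iota b (tsize t).
Proof. exact/perm_mem/perm_word. Qed.

Lemma size_word b t : size (word b t) = tsize t.
Proof. by rewrite (perm_size (perm_word b t)) size_iota. Qed.

Lemma perm_zword b p : perm_eq (zword b p) (0 :: iota b (zsize p)).
Proof.
elim: p b => // -[[] t] p IH b; apply/seq.permP => P; rewrite zsize_cons /=.
- have /seq.permP/(_ P) := perm_iota_cat_max (perm_word b t)
    (perm_refl (iota (b + tsize t) (zsize p))).
  have /seq.permP/(_ P) := IH (b + tsize t).
  by rewrite !count_cat /= => -> <-; lia.
- have /seq.permP/(_ P) := perm_iota_cat_max (perm_refl (iota b (zsize p)))
    (perm_word (b + zsize p) t).
  have /seq.permP/(_ P) := IH b.
  by rewrite [tsize t + _]addnC !count_cat /= => -> <-; lia.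
Qed.

Lemma mem_zword b p : zword b p =i 0 :: iota b (zsize p).
Proof. exact/perm_mem/perm_zword. Qed.

Lemma size_zword b p : size (zword b p) = (zsize p).+1.
Proof. by rewrite (perm_size (perm_zword b p)) /= size_iota. Qed.

Lemma split_inj (T : eqType) (u v u' v' : seq T) x :
  x \notin u -> x \notin u' -> u ++ x :: v = u' ++ x :: v' -> u = u' /\ v = v'.
Proof.
move=> xu xu' eq_uv; have sz : size u = size u'.
  have := congr1 (index x) eq_uv.
  by rewrite !index_cat (negbTE xu) (negbTE xu') /= eqxx !addn0.
by move/eqP: eq_uv; rewrite eqseq_cat // => /andP[/eqP-> /eqP[->]].
Qed.

(** The root carries the largest value, and equal lengths make the two maxima equal, so both words
    are cut at the same place. *)
Lemma word_inj b : injective (word b).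
Proof.
move=> t; elim: t b => [|l IHl r IHr] b [|l' r'] //=;
  try by move/(congr1 size); rewrite size_cat /=; lia.
move=> eqw; have sz : tsize l + tsize r = tsize l' + tsize r'.
  by move/(congr1 size): eqw; rewrite !size_cat /= !size_word; lia.
move: eqw; rewrite -!addnA sz => /split_inj[||/IHl <-].
- by rewrite mem_word mem_iota; lia.
- by rewrite mem_word mem_iota; lia.
by move/IHr=> ->.
Qed.

(** The maximum gives the cut again, and the side containing 0 gives the direction of the path.
    Positivity of [b] keeps 0 apart from the other values. *)
Lemma zword_inj b : 0 < b -> injective (zword b).
Proof.
move=> b0 p; elim: p b b0 => [|[d t] p IH] b b0 [|[d' t'] p'] //=.
- by case: d' => /(congr1 size); rewrite size_cat /= size_zword; lia.
- by case: d => /(congr1 size); rewrite size_cat /= size_zword; lia.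
move=> eqw.
have sz : tsize t + zsize p = tsize t' + zsize p'.
  by case: d d' eqw => -[] /(congr1 size);
    rewrite !size_cat /= !size_word !size_zword; lia.
case: d d' eqw => -[]; rewrite -!addnA.
- rewrite sz => /split_inj[||/word_inj <- /IH-> //]; last lia.
  + by rewrite mem_word mem_iota; lia.
  + by rewrite mem_word mem_iota; lia.
- rewrite sz [zsize p' + _]addnC => /split_inj[||eqw _].
  + by rewrite mem_word mem_iota; lia.
  + by rewrite mem_zword inE mem_iota; lia.
  have : 0 \in zword b p' by rewrite mem_zword mem_head.
  by rewrite -eqw mem_word mem_iota; lia.
- rewrite -sz [zsize p + _]addnC => /split_inj[||eqw _].
  + by rewrite mem_zword inE mem_iota; lia.
  + by rewrite mem_word mem_iota; lia.
  have : 0 \in zword b p by rewrite mem_zword mem_head.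
  by rewrite eqw mem_word mem_iota; lia.
- rewrite [_ + tsize t]addnC [_ + tsize t']addnC sz => /split_inj[||/(IH _ b0)<-].
  + by rewrite mem_zword inE mem_iota; lia.
  + by rewrite mem_zword inE mem_iota; lia.
  by move/word_inj->.
Qed.

(** * Words in which every 231 ends in 0 *)

(** Naming 0 rather than the minimum of [w] makes the property pass to subwords; for a word without
    0 it is avoidance of 231. *)
Definition min231 (w : seq nat) : Prop :=
  forall x y z, subseq [:: x; y; z] w -> z < x < y -> z = 0.

Lemma subseq_catr (T : eqType) (s u v : seq T) : subseq s (u ++ v) ->
  exists s1 s2, [/\ s = s1 ++ s2, subseq s1 u & subseq s2 v].
Proof.
move=> /subseqP[m sz ->].
exists (mask (take (size u) m) u), (mask (drop (size u) m) v).
rewrite !mask_subseq -mask_cat ?cat_take_drop //.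
by rewrite size_take sz size_cat; case: ltngtP; lia.
Qed.

Lemma min231_subseq w w' : subseq w' w -> min231 w -> min231 w'.
Proof. by move=> sw mw x y z /subseq_trans/(_ sw)/mw. Qed.

(** The maximum [M] can only play the 3 of a 231. An occurrence that straddles the cut, with or
    without [M], has its 2 in [u] and its 1 in [v]. *)
Lemma min231_cat_max u v M :
    (forall x, x \in u ++ v -> x < M) ->
  min231 (u ++ M :: v) <->
  [/\ min231 u, min231 v & forall x y, x \in u -> y \in v -> y < x -> y = 0].
Proof.
move=> ltM; split=> [mw|[mu mv muv] x y z].
  split.
  - exact: min231_subseq (prefix_subseq _ _) mw.
  - by apply: min231_subseq mw; rewrite -cat_rcons suffix_subseq.
  - move=> x y xu yv yx; apply: (mw x M y); last by rewrite yx ltM // mem_cat xu.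
    by apply: (@cat_subseq _ [:: x] [:: M; y]); rewrite /= ?eqxx sub1seq.
move=> /subseq_catr[s1 [s2 [es su sv]]].
have ltu a : a \in s1 -> a < M.
  by move=> /(mem_subseq su) au; rewrite ltM // mem_cat au.
have ltv a : a \in s2 -> a = M \/ a \in v /\ a < M.
  move=> /(mem_subseq sv); rewrite inE => /predU1P[->|av]; first by left.
  by right; split=> //; rewrite ltM // mem_cat av orbT.
case: s1 es su ltu => [|a [|b [|c [|? ?]]]] //=.
- move=> es _ _ /andP[zx xy]; subst s2.
  move: sv ltv => /=; case: (eqVneq x M) => [xM _ ltv|xM sv ltv].
    have := ltv y; rewrite !inE eqxx !orbT => -[] // ?; lia.
  by apply: (mv x y z sv); rewrite zx.
- case=> <- es; subst s2; rewrite sub1seq => xu _ /andP[zx xy].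
  have [|?|[zv _]] := ltv z; first by rewrite !inE eqxx orbT.
    by have := ltM x; rewrite mem_cat xu; lia.
  exact: (muv x z).
- case=> <- <- es; subst s2 => su lts /andP[zx xy].
  have [|?|[zv _]] := ltv z; first by rewrite !inE eqxx.
    by have := lts x (mem_head _ _); lia.
  by apply: (muv x z) => //; apply: (mem_subseq su); rewrite inE eqxx.
- by case=> <- <- <- _ su _; apply: mu.
Qed.

(** Sorting the two pieces separately sorts the whole, which is the interval cut at [size u]. *)
Lemma perm_iota_cat (u v : seq nat) b k :
  perm_eq (u ++ v) (iota b k) -> (forall x y, x \in u -> y \in v -> x <= y) ->
  perm_eq u (iota b (size u)) /\ perm_eq v (iota (b + size u) (size v)).
Proof.
move=> puv leuv.
have k_uv : k = size u + size v by rewrite -size_cat (perm_size puv) size_iota.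
have : sort leq u ++ sort leq v = iota b k.
  apply: (sorted_eq leq_trans anti_leq).
  - rewrite (sorted_pairwise leq_trans) pairwise_cat -!(sorted_pairwise leq_trans).
    rewrite !(sort_sorted leq_total) !andbT.
    by apply/allrelP => x y; rewrite !mem_sort; apply: leuv.
  - exact: iota_sorted.
  - by apply: perm_trans puv; apply: perm_cat; rewrite perm_sort.
rewrite k_uv iotaD => /eqP; rewrite eqseq_cat ?size_sort ?size_iota //.
by case/andP => /eqP<- /eqP<-; rewrite ![perm_eq _ (sort _ _)]perm_sym !perm_sort.
Qed.

Lemma perm_rcons_split (w s : seq nat) M : perm_eq w (rcons s M) ->
  exists u v, w = u ++ M :: v /\ perm_eq (u ++ v) s.
Proof.
move=> pw; have Mw : M \in w by rewrite (perm_mem pw) mem_rcons mem_head.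
case/splitPr: Mw pw => u v pw; exists u, v; split=> //.
rewrite -(perm_cons M) -(permPr (permEl (perm_rcons M s))) perm_sym.
by rewrite (permPr (permEl (perm_catCA [:: M] u v))) perm_sym.
Qed.

Lemma iotaSr b k : iota b k.+1 = rcons (iota b k) (b + k).
Proof. by rewrite -addn1 iotaD cats1. Qed.

(** In the absence of 0, the condition across the maximum puts the left entries below the right
    ones, so both sides are intervals and become the subtrees. *)
Lemma word_onto b k w : 0 < b -> perm_eq w (iota b k) -> min231 w ->
  exists t, w = word b t.
Proof.
have [m] := ubnP k; elim: m k b w => // m IH [|k] b w km b0.
  by move=> /perm_size /size0nil ->; exists E.
rewrite iotaSr => /perm_rcons_split[u [v [-> puv]]].
have mem_uv x : x \in u ++ v -> b <= x < b + k by rewrite (perm_mem puv) mem_iota.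
have ltM x : x \in u ++ v -> x < b + k by move=> /mem_uv; lia.
case/(min231_cat_max ltM) => mu mv muv.
have k_uv : k = size u + size v by rewrite -size_cat (perm_size puv) size_iota.
have [|pu pv] := perm_iota_cat puv.
  move=> x y xu yv; rewrite leqNgt; apply/negP => /(muv x y xu yv) y0.
  by have := mem_uv y; rewrite mem_cat yv orbT; lia.
have [|l ul] := IH _ b u _ b0 pu mu; first lia.
have [||r vr] := IH _ _ v _ _ pv mv; [lia | lia | ].
exists (N l r); rewrite /= -(size_word b l) -ul -vr -addnA k_uv.
by rewrite -(size_word (b + size u) r) -vr.
Qed.

Lemma zword_onto b k w : 0 < b -> perm_eq w (0 :: iota b k) -> min231 w ->
  exists p, w = zword b p /\ zsize p = k.
Proof.
have [m] := ubnP k; elim: m k b w => // m IH [|k] b w km b0.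
  by move=> /perm_small_eq -> //; exists [::].
rewrite iotaSr -rcons_cons => /perm_rcons_split[u [v [-> puv]]].
have mem_uv x : x \in u ++ v -> x = 0 \/ b <= x < b + k.
  by rewrite (perm_mem puv) inE mem_iota => /predU1P.
have ltM x : x \in u ++ v -> x < b + k by move=> /mem_uv[]; lia.
case/(min231_cat_max ltM) => mu mv muv.
have : 0 \in u ++ v by rewrite (perm_mem puv) mem_head.
(* The side holding 0 continues the path and the other is a hanging tree. Once 0 is deleted, both
   sides are intervals as before. *)
rewrite mem_cat => /orP[/perm_to_rem|/perm_to_rem].
- move: (rem 0 u) => u' pu0.
  have {}puv : perm_eq (u' ++ v) (iota b k).
    by rewrite -(perm_cons 0) -cat_cons -(permPl (perm_cat pu0 (perm_refl v))).
  have k_uv : k = size u' + size v by rewrite -size_cat (perm_size puv) size_iota.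
  have [|pu pv] := perm_iota_cat puv.
    move=> x y xu yv; rewrite leqNgt; apply/negP => /muv y0.
    have : y \in u' ++ v by rewrite mem_cat yv orbT.
    rewrite (perm_mem puv) mem_iota y0 //; first lia.
    by rewrite (perm_mem pu0) inE xu orbT.
  have [||p [up zp]] := IH (size u') b u _ b0 _ mu; first lia.
    by rewrite (permPl pu0) perm_cons.
  have [|t vt] := word_onto _ pv mv; first lia.
  exists ((false, t) :: p); rewrite zsize_cons /= zp -vt -up k_uv.
  by rewrite -(size_word (b + size u') t) -vt addnA [size v + _]addnC.
- move: (rem 0 v) => v' pv0.
  have {}puv : perm_eq (u ++ v') (iota b k).
    rewrite -(perm_cons 0); apply: perm_trans puv.
    rewrite perm_sym (permPl (perm_cat (perm_refl u) pv0)).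
    exact: (permEl (perm_catCA u [:: 0] v')).
  have k_uv : k = size u + size v' by rewrite -size_cat (perm_size puv) size_iota.
  have [|pu pv] := perm_iota_cat puv.
    move=> x y xu yv; rewrite leqNgt; apply/negP => /muv y0.
    have : y \in u ++ v' by rewrite mem_cat yv orbT.
    rewrite (perm_mem puv) mem_iota y0 //; first lia.
    by rewrite (perm_mem pv0) inE yv orbT.
  have [|||p [vp zp]] := IH (size v') (b + size u) v _ _ _ mv; [lia | lia | |].
    by rewrite (permPl pv0) perm_cons.
  have [|t ut] := word_onto _ pu mu; first lia.
  exists ((true, t) :: p); rewrite zsize_cons /= zp -ut k_uv.
  by rewrite -(size_word b t) -ut -vp addnA.
Qed.

Lemma min231_word b t : min231 (word b t).
Proof.
elim: t b => [|l IHl r IHr] b; first by [].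
apply/min231_cat_max => [x|]; first by rewrite mem_cat !mem_word !mem_iota; lia.
by split=> // x y; rewrite !mem_word !mem_iota; lia.
Qed.

Lemma min231_zword b p : 0 < b -> min231 (zword b p).
Proof.
elim: p b => [|[[] t] p IH] b b0 /=.
- by move=> x y z /size_subseq.
- apply/min231_cat_max => [x|].
    by rewrite mem_cat mem_word mem_zword inE !mem_iota; lia.
  split; [exact: min231_word | by apply: IH; lia |].
  by move=> x y; rewrite mem_word mem_zword inE !mem_iota; lia.
- apply/min231_cat_max => [x|].
    by rewrite mem_cat mem_word mem_zword inE !mem_iota; lia.
  split; [by apply: IH | exact: min231_word |].
  by move=> x y; rewrite mem_word mem_zword inE !mem_iota; lia.
Qed.

(** * Descents and peaks of words, read off the codes *)

Fixpoint wdes (w : seq nat) : nat :=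
  if w is x :: w' then (head x w' < x) + wdes w' else 0.

(** The state of the scan: [x] is the previous letter, and [up] tells whether it was reached by an
    ascent. *)
Fixpoint peaks_after (up : bool) (x : nat) (w : seq nat) : nat :=
  if w is y :: w' then (up && (y < x)) + peaks_after (x < y) y w' else 0.

Definition wpeaks (w : seq nat) : nat :=
  if w is x :: w' then peaks_after false x w' else 0.

Lemma wdes_cat_max u v M : (forall x, x \in u ++ v -> x < M) ->
  wdes (u ++ M :: v) = wdes u + wdes v + (v != [::]).
Proof.
elim: u => [|x u IH] ltM /=.
  by case: v ltM => [|y v] ltM /=; rewrite ?ltnn // ltM ?mem_head //; lia.
have {}IH : wdes (u ++ M :: v) = wdes u + wdes v + (v != [::]).
  by apply: IH => y yuv; rewrite ltM // inE yuv orbT.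
case: u ltM IH => [|y u] ltM -> /=; last by rewrite !addnA.
by have := ltM x (mem_head _ _); rewrite ltnn; lia.
Qed.

Lemma peaks_after_cat_max up x u v M : (forall y, y \in x :: u ++ v -> y < M) ->
  peaks_after up x (u ++ M :: v) = peaks_after up x u + peaks_after true M v.
Proof.
elim: u up x => [|y u IH] up x ltM /=.
  by have xM := ltM x (mem_head _ _); rewrite xM ltnNge ltnW // andbF.
by rewrite IH ?addnA // => z zuv; rewrite ltM // in_cons zuv orbT.
Qed.

(** The neighbours of [M] are peaks neither in the whole word nor in their own piece; [M] is a peak
    when it has letters on both sides. *)
Lemma wpeaks_cat_max u v M : (forall x, x \in u ++ v -> x < M) ->
  wpeaks (u ++ M :: v) = wpeaks u + wpeaks v + ((u != [::]) && (v != [::])).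
Proof.
case: u => [|x u] ltM /=.
  case: v ltM => [|y v] ltM //=.
  by have := ltM y (mem_head _ _); case: ltngtP => //; rewrite addn0.
rewrite peaks_after_cat_max //.
case: v ltM => [|y v] ltM /=; first by rewrite !addn0.
have yM : y < M by rewrite ltM // inE mem_cat mem_head !orbT.
by rewrite yM ltnNge ltnW //=; lia.
Qed.

Lemma word_nil b t : (word b t == [::]) = is_E t.
Proof. by rewrite -size_eq0 size_word tsize_eq0. Qed.

Lemma zword_nil b p : (zword b p == [::]) = false.
Proof. by rewrite -size_eq0 size_zword. Qed.

Lemma size_code e t : size (code e t) = (tsize t).-1.
Proof.
elim: t => // l IHl r IHr; rewrite codeN -!tsize_eq0 /=.
case: eqP => [->|l0]; case: eqP => [->|r0] //=; rewrite ?size_cat /= ?IHl ?IHr; lia.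
Qed.

(** A nonempty hanging tree loses one letter in [code] and gains two around it; the net extra letter
    stands for its parent on the path. *)
Lemma size_zcode p : size (zcode p) = zsize p.
Proof.
elim: p => // -[d t] p IH; rewrite zsize_cons /= -tsize_eq0.
by case: eqP => [->|t0] /=; rewrite ?size_cat ?size_code /= IH; lia.
Qed.

Lemma word_bound b l r x : x \in word b l ++ word (b + tsize l) r ->
  x < b + tsize l + tsize r.
Proof. by rewrite mem_cat !mem_word !mem_iota; lia. Qed.

Lemma zword_bound_left b t p x : 0 < b ->
  x \in word b t ++ zword (b + tsize t) p -> x < b + tsize t + zsize p.
Proof. by move=> b0; rewrite mem_cat mem_word mem_zword inE !mem_iota; lia. Qed.

Lemma zword_bound_right b t p x : 0 < b ->
  x \in zword b p ++ word (b + zsize p) t -> x < b + zsize p + tsize t.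
Proof. by move=> b0; rewrite mem_cat mem_word mem_zword inE !mem_iota; lia. Qed.

(** A right child alone gives [(true, true)]; two children give a U and a D, exactly one of which
    has first component [true], for either [e]. *)
Lemma wdes_word b e t : wdes (word b t) = count fst (code e t).
Proof.
elim: t b => // l IHl r IHr b.
rewrite codeN /= wdes_cat_max; last exact: word_bound.
rewrite IHl IHr word_nil.
case: l r {IHl IHr} => [|? ?] [|? ?];
  rewrite /= ?count_cat /=; case: e => /=; lia.
Qed.

Lemma wpeaks_word b e t : wpeaks (word b t) = count_mem (true, false) (code e t).
Proof.
elim: t b => // l IHl r IHr b.
rewrite codeN /= wpeaks_cat_max; last exact: word_bound.
rewrite IHl IHr !word_nil.
case: l r {IHl IHr} => [|? ?] [|? ?];
  rewrite /= ?count_cat /=; case: e => /=; lia.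
Qed.

Lemma wdes_zword b p : 0 < b -> wdes (zword b p) = count fst (zcode p).
Proof.
elim: p b => // -[[] t] p IH b b0 /=; rewrite wdes_cat_max.
- rewrite (wdes_word _ false) IH ?zword_nil; last lia.
  by case: (boolP (is_E t)) => Et /=; rewrite ?count_cat /=;
    case: t Et => //=; lia.
- by move=> x; apply: zword_bound_left.
- rewrite (wdes_word _ true) IH // word_nil.
  by case: (boolP (is_E t)) => Et /=; rewrite ?count_cat /=;
    case: t Et => //=; lia.
- by move=> x; apply: zword_bound_right.
Qed.

Lemma wpeaks_zword b p : 0 < b ->
  wpeaks (zword b p) = count_mem (true, false) (zcode p).
Proof.
elim: p b => // -[[] t] p IH b b0 /=; rewrite wpeaks_cat_max.
- rewrite (wpeaks_word _ false) IH ?zword_nil ?word_nil; last lia.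
  by case: (boolP (is_E t)) => Et /=; rewrite ?count_cat /=;
    case: t Et => //=; lia.
- by move=> x; apply: zword_bound_left.
- rewrite (wpeaks_word _ true) IH // zword_nil word_nil.
  by case: (boolP (is_E t)) => Et /=; rewrite ?count_cat /=;
    case: t Et => //=; lia.
- by move=> x; apply: zword_bound_right.
Qed.

(** * Permutations as words *)

Definition one_line n (s : 'S_n) : seq nat := [seq val (s i) | i <- enum 'I_n].

Lemma size_one_line n (s : 'S_n) : size (one_line s) = n.
Proof. by rewrite size_map size_enum_ord. Qed.

Lemma nth_one_line n (s : 'S_n) (i : 'I_n) x : nth x (one_line s) i = s i.
Proof. by rewrite (nth_map i) ?size_enum_ord // nth_ord_enum. Qed.

Lemma one_line_inj n : injective (@one_line n).
Proof.
move=> s s' eqw; apply/permP => i; apply: val_inj.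
by rewrite /= -!(nth_one_line _ _ 0) eqw.
Qed.

Lemma perm_one_line n (s : 'S_n) : perm_eq (one_line s) (iota 0 n).
Proof.
rewrite -val_enum_ord /one_line (map_comp val s); apply: perm_map.
apply: uniq_perm; rewrite ?enum_uniq ?(map_inj_uniq (@perm_inj _ s)) ?enum_uniq //.
by move=> i; rewrite mem_enum -[i](permKV s) map_f ?mem_enum.
Qed.

Lemma one_line_onto n w : perm_eq w (iota 0 n) -> exists s : 'S_n, one_line s = w.
Proof.
move=> pw; have sz : size w = n by rewrite (perm_size pw) size_iota.
have ltn (i : 'I_n) : nth 0 w i < n.
  have : nth 0 w i \in w by rewrite mem_nth // sz.
  by rewrite (perm_mem pw) mem_iota.
have f_inj : injective (fun i => Ordinal (ltn i)).
  move=> i j [] /eqP; rewrite nth_uniq ?sz // ?(perm_uniq pw) ?iota_uniq //.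
  by move/eqP/val_inj.
exists (perm f_inj); apply: (@eq_from_nth _ 0);
  rewrite size_one_line ?sz // => i lt_i.
by rewrite (nth_one_line _ (Ordinal lt_i)) permE.
Qed.

(** Reading past the end yields the default 0, which could count as a descent; hence the guard
    [i.+1 < size w]. *)
Lemma wdesE w : wdes w =
  \sum_(i < size w) ((i.+1 < size w) && (nth 0 w i.+1 < nth 0 w i)).
Proof.
elim: w => [|x w IH] /=; first by rewrite big_ord0.
by rewrite big_ord_recl /= IH; congr addn; case: w {IH} => [|y w] /=; rewrite ?ltnn.
Qed.

Lemma peaks_afterE up x w : peaks_after up x w =
  \sum_(i < size w) [&& nth 0 (x :: w) i.+1 < nth 0 (x :: w) i
    & if val i is j.+1 then nth 0 (x :: w) j < nth 0 (x :: w) j.+1 else up].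
Proof.
elim: w up x => [|y w IH] up x /=; first by rewrite big_ord0.
rewrite big_ord_recl /= IH andbC; congr addn.
by apply: eq_bigr => -[[|i] lti] _.
Qed.

Lemma wpeaksE w : wpeaks w =
  \sum_(i < size w) [&& 0 < i, i.+1 < size w,
    nth 0 w i.-1 < nth 0 w i & nth 0 w i.+1 < nth 0 w i].
Proof.
case: w => [|x w] /=; first by rewrite big_ord0.
rewrite big_ord_recr /= ltnn andbF addn0 peaks_afterE.
by apply: eq_bigr => -[[|i] lti] _ //=; rewrite ?andbF // ltnS lti andbC.
Qed.

Lemma card_descents n (s : 'S_n) : #|descents s| = wdes (one_line s).
Proof.
rewrite wdesE size_one_line -sum1_card big_mkcond /=; apply: eq_bigr => i _.
rewrite inE; set a := [exists j, _]; set c := _ && _.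
suff -> : a = c by case: c.
apply/existsP/andP => [[j /andP[/eqP ji lt_s]]|[lt_i lt_s]].
  by rewrite -ji !nth_one_line.
exists (Ordinal lt_i); rewrite /= eqxx.
by move: lt_s; rewrite (nth_one_line _ (Ordinal lt_i)) nth_one_line.
Qed.

Lemma card_peaks n (s : 'S_n) : #|peaks s| = wpeaks (one_line s).
Proof.
rewrite wpeaksE size_one_line -sum1_card big_mkcond /=; apply: eq_bigr => i _.
rewrite inE; set a := [exists j, _]; set c := [&& _, _, _ & _].
suff -> : a = c by case: c.
apply/existsP/and4P => [[h /existsP[j /and4P[/eqP ih /eqP ji lt_h lt_j]]]|].
  have -> : i.-1 = h by rewrite ih.
  by rewrite -ji !nth_one_line {1}ih lt_h lt_j ltn_ord.
case=> i0 lt_i lt_h lt_j.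
have lt_i' : i.-1 < n by lia.
exists (Ordinal lt_i'); apply/existsP; exists (Ordinal lt_i).
move: lt_h lt_j; rewrite (nth_one_line _ (Ordinal lt_i)).
by rewrite (nth_one_line _ (Ordinal lt_i')) nth_one_line => -> ->; 
  rewrite /= prednK ?eqxx.
Qed.

Lemma subseq_enum_ord n (t : seq 'I_n) :
  subseq t (enum 'I_n) = sorted (fun i j : 'I_n => i < j) t.
Proof.
have sorted_enum : sorted (fun i j : 'I_n => i < j) (enum 'I_n).
  by have := iota_ltn_sorted 0 n; rewrite -val_enum_ord sorted_map.
have ltn_trans' : transitive (fun i j : 'I_n => i < j).
  by move=> ? ? ?; apply: ltn_trans.
apply/idP/idP => [st|st]; first exact: (subseq_sorted ltn_trans' st).
apply/(subseq_uniqP (enum_uniq _)).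
apply: (irr_sorted_eq ltn_trans') => //.
- by move=> i; rewrite /= ltnn.
- exact: sorted_filter.
- by move=> i; rewrite mem_filter mem_enum andbT.
Qed.

Lemma min231_one_line n (s : 'S_n) : min231 (one_line s) <->
  forall i j k : 'I_n, i < j < k -> s k < s i < s j -> s k = 0 :> nat.
Proof.
split=> [ms i j k ijk|ms x y z /subseqP[m _]].
  apply: ms; apply: (@map_subseq _ _ (fun i => val (s i)) [:: i; j; k]).
  by rewrite subseq_enum_ord /= andbT.
rewrite -map_mask; have := mask_subseq m (enum 'I_n); rewrite subseq_enum_ord.
case: (mask m _) => [|i [|j [|k [|? ?]]]] //= st [-> -> ->].
by apply: ms; move: st; rewrite andbT.
Qed.

(** * Avoidance of the four patterns *)

Lemma containsP n (s : 'S_n) (tau : seq nat) :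
  reflect (exists f : 'I_(size tau) -> 'I_n,
      (forall i j : 'I_(size tau), i < j -> f i < f j)
      /\ forall i j : 'I_(size tau),
          (nth 0 tau i < nth 0 tau j) = (s (f i) < s (f j)))
    (contains s tau).
Proof.
apply: (iffP existsP) => [[f /andP[/forallP mf /forallP ef]]|[f [mf ef]]].
  exists f; split=> i j; first exact: implyP (forallP (mf i) j).
  exact: eqP (forallP (ef i) j).
exists (finfun f); apply/andP; split; apply/forallP => i; apply/forallP => j.
  by apply/implyP; rewrite !ffunE; apply: mf.
by rewrite !ffunE; apply/eqP; apply: ef.
Qed.

Lemma contains4 n (s : 'S_n) t0 t1 t2 t3 (a b c d : 'I_n) :
    a < b -> b < c -> c < d ->
    (forall i j, i < 4 -> j < 4 ->
      (nth 0 [:: t0; t1; t2; t3] i < nth 0 [:: t0; t1; t2; t3] j)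
      = (s (nth a [:: a; b; c; d] i) < s (nth a [:: a; b; c; d] j))) ->
  contains s [:: t0; t1; t2; t3].
Proof.
move=> ab bc cd iso; apply/containsP; exists (nth a [:: a; b; c; d]).
split=> i j; last exact: iso.
by case: i j => [[|[|[|[|//]]]] ?] [[|[|[|[|//]]]] ?] //= _; lia.
Qed.

(** A 231 whose last letter is not 0 forms one of the four patterns together with 0; the gap into
    which the position of 0 falls decides which. *)
Lemma mem_Av_patterns n (s : 'S_n) :
  s \in Av n patterns <-> min231 (one_line s).
Proof.
rewrite min231_one_line inE; split=> [/= avs i j k ijk sijk|ms].
  apply/eqP; rewrite -leqn0 leqNgt; apply/negP => sk.
  have n0 : 0 < n by apply: leq_ltn_trans (ltn_ord i).
  pose p := s^-1%g (Ordinal n0).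
  have sp : s p = 0 :> nat by rewrite permKV.
  move: avs => /and5P[/negP a1 /negP a2 /negP a3 /negP a4 _].
  have neq (q : 'I_n) : 0 < s q -> p != q :> nat.
    by move=> sq; apply: contraTneq sq => /val_inj <-; rewrite sp.
  have pi := neq i; have pj := neq j; have pk := neq k.
  have [lt_pi|ge_pi] := ltnP p i.
    apply: a1; apply: (@contains4 _ _ _ _ _ _ p i j k); try lia.
    by move=> [|[|[|[|//]]]] [|[|[|[|//]]]] //= _ _; lia.
  have [lt_pj|ge_pj] := ltnP p j.
    apply: a2; apply: (@contains4 _ _ _ _ _ _ i p j k); try lia.
    by move=> [|[|[|[|//]]]] [|[|[|[|//]]]] //= _ _; lia.
  have [lt_pk|ge_pk] := ltnP p k.
    apply: a3; apply: (@contains4 _ _ _ _ _ _ i j p k); try lia.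
    by move=> [|[|[|[|//]]]] [|[|[|[|//]]]] //= _ _; lia.
  apply: a4; apply: (@contains4 _ _ _ _ _ _ i j k p); try lia.
  by move=> [|[|[|[|//]]]] [|[|[|[|//]]]] //= _ _; lia.
pose o j (lt_j : j < 4) : 'I_4 := Ordinal lt_j.
(* In each pattern [ms] applies to the letters 342 and gives the 2 the value 0, yet the 1 lies below
   it. *)
rewrite /= andbT; apply/and4P; split; apply/containsP => -[f [mf ef]].
- have := ms (f (o 1 isT)) (f (o 2 isT)) (f (o 3 isT)).
  rewrite !mf // -!ef => /(_ isT isT) s0.
  by have := ef (o 0 isT) (o 3 isT); rewrite s0.
- have := ms (f (o 0 isT)) (f (o 2 isT)) (f (o 3 isT)).
  rewrite !mf // -!ef => /(_ isT isT) s0.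
  by have := ef (o 1 isT) (o 3 isT); rewrite s0.
- have := ms (f (o 0 isT)) (f (o 1 isT)) (f (o 3 isT)).
  rewrite !mf // -!ef => /(_ isT isT) s0.
  by have := ef (o 2 isT) (o 3 isT); rewrite s0.
- have := ms (f (o 0 isT)) (f (o 1 isT)) (f (o 2 isT)).
  rewrite !mf // -!ef => /(_ isT isT) s0.
  by have := ef (o 3 isT) (o 2 isT); rewrite s0.
Qed.

(** * The three counts *)

Lemma count_fst w :
  count fst w = count_mem (true, false) w + count_mem (true, true) w.
Proof. by elim: w => // -[[] []] w /= ->; lia. Qed.

Lemma count_snd w :
  count snd w = count_mem (false, true) w + count_mem (true, true) w.
Proof. by elim: w => // -[[] []] w /= ->; lia. Qed.

(** The second hypothesis confines [Q] to balanced words, the only codes. Base 1 reserves 0 for the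
    marked leaf. *)
Lemma card_Av_code k (P : pred 'S_k.+1) (Q : pred (seq letter)) :
    (forall s p, one_line s = zword 1 p -> P s = Q (zcode p)) ->
    (forall w, Q w -> count_mem (true, false) w = count_mem (false, true) w) ->
  #|[set s in Av k.+1 patterns | P s]| = count Q (words k).
Proof.
move=> PQ Qbal; rewrite -size_filter.
apply: (@card_eq_size_of_rel _ _
  (fun s w => exists2 p, one_line s = zword 1 p & zcode p = w)).
- exact/filter_uniq/words_uniq.
- move=> s; rewrite inE => /andP[/mem_Av_patterns ms Ps].
  have [p [sp zp]] := @zword_onto 1 k _ isT (perm_one_line s) ms.
  exists (zcode p); last by exists p.
  by rewrite mem_filter mem_words size_zcode zp eqxx -(PQ s) ?Ps.
- move=> w; rewrite mem_filter mem_words => /andP[Qw /eqP sw].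
  have [p wp] := zcode_parse (Qbal w Qw).
  have [|s sp] := @one_line_onto k.+1 (zword 1 p).
    by rewrite -sw wp size_zcode; apply: perm_zword.
  exists s; last by exists p.
  rewrite inE (PQ s p sp) -wp Qw andbT; apply/mem_Av_patterns.
  by rewrite sp; apply: min231_zword.
- move=> s w w' [p sp <-] [p' sp' <-].
  by congr zcode; apply: (@zword_inj 1) => //; rewrite -sp.
- move=> s s' w [p sp <-] [p' sp' /zcode_inj ep].
  by apply: one_line_inj; rewrite sp sp' ep.
Qed.

Lemma card_Av_descents k m :
  #|[set s in Av k.+1 patterns | #|descents s| == m]| = 'C(k, m) ^ 2.
Proof.
rewrite -mulnn -count_words_fst_snd.
apply: card_Av_code => [s p sp|w /andP[/eqP wf /eqP ws]].
  (* In a code both components are [true] equally often, so the condition on descents doubles into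
     one on [fst] and one on [snd]. *)
  rewrite card_descents sp wdes_zword // count_snd -zcode_balanced -count_fst.
  by rewrite andbb.
apply/eqP; rewrite -(eqn_add2r (count_mem (true, true) w)).
by rewrite -count_fst -count_snd wf ws.
Qed.

Lemma card_Av_peaks k m :
  #|[set s in Av k.+1 patterns | #|peaks s| == m]|
  = 2 ^ (k - 2 * m) * 'C(k, 2 * m) * 'C(2 * m, m).
Proof.
rewrite mul2n -addnn -count_words_peaks.
apply: card_Av_code => [s p sp|w /andP[/eqP -> /eqP -> //]].
by rewrite card_peaks sp wpeaks_zword // -zcode_balanced andbb.
Qed.

Lemma card_Av k : #|Av k.+1 patterns| = 'C(2 * k, k).
Proof.
(* The descents are bounded only by the size [k.+1] of the index type, so the sum runs one term
   further than usual; that term vanishes. *)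
have -> : 'C(2 * k, k) = \sum_(m < k.+2) 'C(k, m) ^ 2.
  rewrite big_ord_recr /= (@bin_small k k.+1) // exp0n // addn0.
  rewrite mul2n -addnn -Vandermonde.
  by apply: eq_bigr => m _; rewrite bin_sub ?mulnn // -ltnS.
rewrite -sum1_card.
rewrite (partition_big (fun s => inord #|descents s| : 'I_k.+2) xpredT) //=.
apply: eq_bigr => m _; rewrite -card_Av_descents -sum1_card.
apply: eq_bigl => s.
rewrite inE -val_eqE /= inordK // ltnS.
by rewrite -[X in _ <= X]card_ord max_card.
Qed.

Theorem corollary5p1 (n : nat) (hn : 1 <= n) :
  #|Av n patterns| = 'C(2 * n - 2, n - 1)
  /\ (forall m : nat,
        #|[set s in Av n patterns | #|descents s| == m]| = 'C(n - 1, m) ^ 2)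
  /\ (forall m : nat,
        #|[set s in Av n patterns | #|peaks s| == m]|
        = 2 ^ (n - 2 * m - 1) * 'C(n - 1, 2 * m) * 'C(2 * m, m)).
Proof.
case: n hn => // k _; rewrite subn1 /=; split; [|split=> m].
- have -> : 2 * k.+1 - 2 = 2 * k by lia.
  exact: card_Av.
- exact: card_Av_descents.
- by rewrite subnAC subn1; apply: card_Av_peaks.
Qed.
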